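(* Let $\mathbb{Z}_2$ denote the two-element group. For each of the groups $G = \bigoplus_{\mathbb{N}} \mathbb{Z}_2$ (direct sum of countably infinitely many copies of $\mathbb{Z}_2$) and $G = \mathbb{Z}_2 \wr \mathbb{Z}$ (the lamplighter group), there exists a vector shift $X$ over the two-element field on the group $G$ such that its group of homoclinic points $\Delta_X$ is not finitely orbit-generated.
   Context: Let $G$ be a group and $A$ a finite set. $A^G$ has the product topology and the left shift action $(gx)_h = x_{g^{-1}h}$; a $G$-subshift is a closed $G$-invariant subset of $A^G$. A vector shift over a finite field $K$ on $G$ is a $G$-subshift equipped with a $K$-vector space structure whose operations (zero, addition, scalar multiplications) are continuous and commute with the shift action. A point $x \in X$ is homoclinic if $gx \to 0$ as $g$ escapes finite subsets of $G$; $\Delta_X$ is the (shift-invariant) subgroup of $(X,+)$ of all homoclinic points. $\Delta_X$ is finitely orbit-generated if there is a finite set $Y$ such that $\Delta_X$ is generated, algebraically as a discrete group, by $\{gy : g \in G,\ y \in Y\}$. *)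

(* Defs.v *)
From HB Require Import structures.
From mathcomp Require Import all_boot all_order all_algebra finmap.
From mathcomp Require Import boolp classical_sets functions cardinality topology.

Set Implicit Arguments.
Unset Strict Implicit.
Unset Printing Implicit Defensive.

Import GRing.Theory.

Local Open Scope classical_set_scope.
Local Open Scope fset_scope.
Local Open Scope group_scope.

(** * Direct sums and restricted wreath products *)

Definition dsum (I : choiceType) (H : groupType) : Type :=
  {fsfun I -> H of i => 1}.

Section DirectSum.
Variables (I : choiceType) (H : groupType).
Local Notation D := (dsum I H).
Implicit Types f g h : D.

HB.instance Definition _ := Choice.on D.

Definition dsum_one : D := [fsfun].

Definition dsum_inv f : D :=
  [fsfun i in finsupp f => (f i)^-1 | 1].

Definition dsum_mul f g : D :=
  [fsfun i in finsupp f `|` finsupp g => f i * g i | 1].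

Lemma dsum_oneE i : dsum_one i = 1.
Proof. by rewrite fsfunE. Qed.

Lemma dsum_invE f i : dsum_inv f i = (f i)^-1.
Proof. by rewrite fsfunE; case: finsuppP => //; rewrite invg1. Qed.

Lemma dsum_mulE f g i : dsum_mul f g i = f i * g i.
Proof.
rewrite fsfunE in_fsetU; case: (finsuppP f i) => //=.
by case: (finsuppP g i) => //; rewrite mulg1.
Qed.

Lemma dsum_mulA : associative dsum_mul.
Proof. by move=> f g h; apply/fsfunP => i; rewrite !dsum_mulE mulgA. Qed.

Lemma dsum_mul1 : left_id dsum_one dsum_mul.
Proof. by move=> f; apply/fsfunP => i; rewrite dsum_mulE dsum_oneE mul1g. Qed.

Lemma dsum_mul1r : right_id dsum_one dsum_mul.
Proof. by move=> f; apply/fsfunP => i; rewrite dsum_mulE dsum_oneE mulg1. Qed.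

Lemma dsum_mulV : left_inverse dsum_one dsum_inv dsum_mul.
Proof.
by move=> f; apply/fsfunP => i; rewrite dsum_mulE dsum_invE dsum_oneE mulVg.
Qed.

Lemma dsum_mulVr : right_inverse dsum_one dsum_inv dsum_mul.
Proof.
by move=> f; apply/fsfunP => i; rewrite dsum_mulE dsum_invE dsum_oneE mulgV.
Qed.

HB.instance Definition _ := isGroup.Build D
  dsum_mulA dsum_mul1 dsum_mul1r dsum_mulV dsum_mulVr.

End DirectSum.

(** The semidirect product of the direct sum of copies of [H] indexed by [Q]
    with [Q], the latter acting by left translation of the indices. *)
Definition wreath (H Q : groupType) : Type := (dsum Q H * Q)%type.

Section Wreath.
Variables H Q : groupType.
Local Notation D := (dsum Q H).
Local Notation W := (wreath H Q).
Implicit Types (f g : D) (p q : Q) (u v w : W).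

HB.instance Definition _ := Choice.on W.

Definition translate q f : D :=
  [fsfun x in [fset q * y | y in finsupp f] => f (q^-1 * x) | 1].

Definition wreath_one : W := (1, 1).

Definition wreath_inv u : W := (translate u.2^-1 u.1^-1, u.2^-1).

Definition wreath_mul u v : W := (u.1 * translate u.2 v.1, u.2 * v.2).

Lemma translateE q f x : translate q f x = f (q^-1 * x).
Proof.
rewrite fsfunE; case: ifPn => // /imfsetP xP.
case: (finsuppP f (q^-1 * x)) => // sx.
by case: xP; exists (q^-1 * x); rewrite //= mulgA mulgV mul1g.
Qed.

Lemma translate1 f : translate 1 f = f.
Proof. by apply/fsfunP => x; rewrite translateE invg1 mul1g. Qed.

Lemma translateM p q f : translate (p * q) f = translate p (translate q f).
Proof. by apply/fsfunP => x; rewrite !translateE invgM mulgA. Qed.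

Lemma translate_mul q f g : translate q (f * g) = translate q f * translate q g.
Proof.
by apply/fsfunP => x; rewrite [RHS]dsum_mulE !translateE [LHS]dsum_mulE.
Qed.

Lemma translate_one q : translate q 1 = 1.
Proof. by apply/fsfunP => x; rewrite translateE !dsum_oneE. Qed.

Lemma wreath_mulA : associative wreath_mul.
Proof.
by move=> u v w; rewrite /wreath_mul /= translate_mul translateM !mulgA.
Qed.

Lemma wreath_mul1 : left_id wreath_one wreath_mul.
Proof. by case=> f q; rewrite /wreath_mul /= translate1 !mul1g. Qed.

Lemma wreath_mul1r : right_id wreath_one wreath_mul.
Proof. by case=> f q; rewrite /wreath_mul /= translate_one !mulg1. Qed.

Lemma wreath_mulV : left_inverse wreath_one wreath_inv wreath_mul.
Proof.
by case=> f q; rewrite /wreath_mul /= -translate_mul !mulVg translate_one.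
Qed.

Lemma wreath_mulVr : right_inverse wreath_one wreath_inv wreath_mul.
Proof.
by case=> f q; rewrite /wreath_mul /= -translateM !mulgV translate1 mulgV.
Qed.

HB.instance Definition _ := isGroup.Build W
  wreath_mulA wreath_mul1 wreath_mul1r wreath_mulV wreath_mulVr.

End Wreath.

(** The canonical group law of ['Z_2] is its addition. *)
Definition lamplighter : groupType :=
  wreath 'Z_2 (Algebra.to_multiplicative int).

(** * Subshifts *)

Definition config (G : Type) (A : finType) : topologicalType :=
  {ptws G -> discrete_topology A}.

Definition shift (G : groupType) (A : finType) (g : G) (x : config G A) :
  config G A := fun h => x (g^-1 * h).

Record subshift (G : groupType) (A : finType) := Subshift {
  subshift_set :> set (config G A);
  subshift_closed : closed subshift_set;
  subshift_shift : forall g x, subshift_set x -> subshift_set (shift g x)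
}.

Section SubshiftAction.
Variables (G : groupType) (A : finType) (X : subshift G A).

Lemma act_subproof (g : G) (x : X) : shift g (val x) \in (X : set _).
Proof. exact/mem_set/subshift_shift/set_mem/valP. Qed.

Definition act (g : G) (x : X) : X :=
  exist _ (shift g (val x)) (act_subproof g x).

End SubshiftAction.

(** * Vector shifts *)

(** [vs_lmod] puts an arbitrary [K]-vector space structure on the points of the
    subshift: it need not be the restriction of a cellwise one.  Since [X]
    and [vs_space] are the same type, the casts below only select the
    structure: topological for [X], algebraic for [vs_space]. *)
Record vector_shift (K : finFieldType) (G : groupType) (A : finType) :=
  VectorShift {
  vs_points :> subshift G A;
  vs_lmod : GRing.Lmodule K (vs_points : Type);
  vs_space : lmodType K := GRing.Lmodule.Pack vs_lmod;
  vs_add_continuous : continuous (fun p : (vs_points * vs_points)%type =>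
    ((p.1 : vs_space) + (p.2 : vs_space))%R : vs_points);
  vs_scale_continuous : forall a : K, continuous (fun x : vs_points =>
    (a *: (x : vs_space))%R : vs_points);
  vs_act0 : forall g, act g (0%R : vs_space) = (0%R : vs_space);
  vs_actD : forall g (x y : vs_space),
    act g (x + y)%R = ((act g x : vs_space) + (act g y : vs_space))%R;
  vs_actZ : forall g (a : K) (x : vs_space),
    act g (a *: x)%R = (a *: (act g x : vs_space))%R
}.

(** * Homoclinic points *)

(** Convergence along this filter is convergence as [t] leaves every finite
    subset of [T]. *)
Definition cofinite_filter (T : Type) : set_system T := [set S | cofinite_set S].

Global Instance cofinite_filterP (T : Type) : Filter (@cofinite_filter T).
Proof.
split; rewrite /cofinite_filter /=.
- by rewrite setCT; exact: finite_set0.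
- by move=> P Q fP fQ /=; rewrite setCI finite_setU.
- by move=> P Q PQ /=; apply: sub_finite_set; exact: subsetC.
Qed.

Definition generated (V : zmodType) (S : set V) : set V :=
  smallest [set H : set V | GRing.zmod_closed [in H]] S.

Section Homoclinic.
Variables (K : finFieldType) (G : groupType) (A : finType).
Variable X : vector_shift K G A.

Definition homoclinic : set (vs_space X) :=
  [set x | (fun g => act g x) @ @cofinite_filter G -->
           ((0%R : vs_space X) : X)].

Definition orbits (Y : set (vs_space X)) : set (vs_space X) :=
  [set act g y | g in [set: G] & y in Y].

Definition finitely_orbit_generated : Prop :=
  exists2 Y : set (vs_space X), finite_set Y & homoclinic = generated (orbits Y).

End Homoclinic.

(* Main.v *)
(** Both groups contain commuting involutions [u_0, u_1, ...], independent in
    the sense that right multiplication by [u_i] flips exactly the [i]-th of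
    some finitely supported binary coordinates on [G].  Put [a_n = u_(2n)] and
    [b_n = u_(2n+1)].  Let [X] consist of the [x : G -> F_2] whose sum over each
    left coset of [<a_n, b_n, b_0, ..., b_(n-1)>] vanishes, for all [n].

    Homoclinic points of [X] have finite support.  If the coordinates of [a_n]
    and [b_n] vanish on the support of [x], then each coset of
    [<a_n, b_n, b_0, ..., b_(n-1)>] meets that support within a single coset of
    [<b_0, ..., b_(n-1)>], so already the sums of [x] over cosets of the latter
    vanish; this condition is linear and shift-invariant.  For large [n] it
    thus holds on the whole group generated by finitely many orbits, but it
    fails for the indicator function of [<a_0, ..., a_(n-1), b_n>], which is a
    homoclinic point of [X]. *)

Require Import Defs.
From HB Require Import structures.
From mathcomp Require Import all_boot all_order all_algebra finmap.
From mathcomp Require Import boolp classical_sets functions cardinality topology.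
Import GRing.Theory.
Set Implicit Arguments.
Unset Strict Implicit.
Unset Printing Implicit Defensive.

(** * Vector shifts with cellwise operations *)

Lemma config_near (G : groupType) (A : finType) (x : config G A) h :
  (\forall y \near x, y h = x h)%classic.
Proof.
exact: (@proj_continuous G (fun=> discrete_topology A) h x)
  (discrete_set1 (x h : discrete_topology A)).
Qed.

Section Cellwise.
Local Open Scope classical_set_scope.
Local Open Scope ring_scope.
Variables (K : finFieldType) (G : groupType) (X : subshift G K).
Local Notation V := (G -> K^o).

Definition cellwise_points : {pred V} := [in (X : set (config G K))].

Hypothesis X_submod : GRing.submod_closed cellwise_points.

HB.instance Definition _ :=
  GRing.isSubmodClosed.Build K V cellwise_points X_submod.
Definition cellwise : Type := {x : V | x \in cellwise_points}.
HB.instance Definition _ := SubChoice.on cellwise.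
HB.instance Definition _ := [SubChoice_isSubLmodule of cellwise by <:].

Lemma val_continuous : continuous (val : X -> config G K).
Proof. exact: initial_continuous. Qed.

(** [X] carries the initial topology of [val], and the product topology is the supremum of those
    pulled back along the coordinates. The alphabet being discrete, it is enough that each
    coordinate is eventually constant. *)
Lemma subshift_cvg (T : Type) (F : set_system T) (f : T -> X) (x : X) :
  Filter F ->
  (forall h, \forall t \near F, val (f t) h = val x h) -> f @ F --> x.
Proof.
move=> FF fx; suff cv : (fun t => val (f t)) @ F --> (val x : config G K).
  move=> U [_ [[B Bop <-] Bx] BU].
  have /cv FB : nbhs (val x : config G K) B by apply: open_nbhs_nbhs.
  rewrite nbhs_filterE in FB; rewrite nbhs_filterE -[_ U]/(F (f @^-1` U)).
  by apply: (@filterS _ F FF _ _ _ FB) => t; exact: BU.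
rewrite cvg_sup => h; rewrite cvg_image; last first.
  by rewrite eqEsubset; split=> // a _; exists (fun=> a).
move=> U /= Ux; exists [set z : G -> discrete_topology K | U (z h)].
  by apply: filterS (fx h) => t /= ->; exact: nbhs_singleton Ux.
by rewrite eqEsubset; split=> [_ [z Uz <-] //|a Ua]; exists (fun=> a).
Qed.

Lemma coord_near (x : X) h : \forall y \near x, val y h = val x h.
Proof. exact: val_continuous (@config_near _ _ (val x) h). Qed.

Fact cellwise_add_continuous : continuous (fun p : (X * X)%type =>
    ((p.1 : cellwise) + (p.2 : cellwise)) : X).
Proof.
case=> x y; apply: subshift_cvg => h.
exists ([set z | val z h = val x h], [set z | val z h = val y h]).
  by split; exact: coord_near.
by case=> z w [/= zx wy]; congr (_ + _).
Qed.

Fact cellwise_scale_continuous (a : K) : continuous (fun x : X =>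
    (a *: (x : cellwise)) : X).
Proof.
move=> x; apply: (@subshift_cvg _ (nbhs x) _ _ (nbhs_filter x)) => h.
apply: (@filterS _ (nbhs x) (nbhs_filter x) _ _ _ (@coord_near x h)) => z zx.
exact: (congr1 (fun b => a * b) zx).
Qed.

Fact cellwise_act0 g : act g ((0 : cellwise) : X) = (0 : cellwise).
Proof. exact/val_inj. Qed.
Fact cellwise_actD g (x y : cellwise) :
  act g ((x + y) : X) = (act g (x : X) : cellwise) + (act g (y : X) : cellwise).
Proof. exact/val_inj. Qed.
Fact cellwise_actZ g a (x : cellwise) :
  act g ((a *: x) : X) = a *: (act g (x : X) : cellwise).
Proof. exact/val_inj. Qed.

Definition cellwise_vector_shift : vector_shift K G K :=
  @VectorShift K G K X (GRing.Lmodule.class (cellwise : lmodType K))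
   cellwise_add_continuous cellwise_scale_continuous cellwise_act0 cellwise_actD
    cellwise_actZ.
End Cellwise.

(** * The vector shift attached to independent commuting involutions *)

Section Differences.
Local Open Scope classical_set_scope.
Local Open Scope ring_scope.
Variables (G : groupType) (u : nat -> G) (c : G -> nat -> bool).
Hypotheses (u_invol : forall i, (u i * u i)%g = 1%g)
  (u_comm : forall i j, (u i * u j)%g = (u j * u i)%g)
  (c_u : forall g i j, c (g * u i)%g j = c g j (+) (i == j))
  (c_1 : forall i, c 1%g i = false)
  (c_fin : forall g, exists N, forall i, (N <= i)%N -> c g i = false).
Local Notation V := (G -> ('F_2)^o).
Implicit Types (x y : V) (g : G) (i n : nat) (s : seq nat).

(** Iterating [diff] along distinct [i_1, ..., i_k] sums [x] over the left cosets
    of [<u_(i_1), ..., u_(i_k)>]. *)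
Definition diff i x : V := fun g => x g + x (g * u i)%g.
Definition diffs s x : V := foldr diff x s.
Definition delta : V := fun g => (g == 1%g)%:R.

Lemma addFF (a : 'F_2) : a + a = 0.
Proof. by apply/val_inj; case: a => [[|[|]]]. Qed.

Lemma diff0 i : diff i 0 = 0.
Proof. by apply/funext => g; rewrite /diff addr0. Qed.

Lemma diffs0 s : diffs s 0 = 0.
Proof. by elim: s => //= i s ->; rewrite diff0. Qed.

Lemma diffs_cat s1 s2 x : diffs (s1 ++ s2) x = diffs s1 (diffs s2 x).
Proof. exact: foldr_cat. Qed.

Lemma diffs_linear s : linear (diffs s).
Proof.
move=> a x y; elim: s => //= i s ->; apply/funext => g.
by rewrite /diff !fctE scalerDr addrACA.
Qed.

Lemma diffC i j x : diff i (diff j x) = diff j (diff i x).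
Proof.
by apply/funext => g; rewrite /diff addrACA -!mulgA u_comm.
Qed.

Lemma diffK i x : diff i (diff i x) = 0.
Proof.
by apply/funext => g; rewrite /diff -mulgA u_invol mulg1 [X in _ + X]addrC addFF.
Qed.

Lemma diff_diffs i s x : i \in s -> diff i (diffs s x) = 0.
Proof.
elim: s => //= j s IH; rewrite in_cons => /orP[/eqP->|/IH e]; first exact: diffK.
by rewrite diffC e diff0.
Qed.

(** The operators [diff i] commute, and each squares to zero because [u i] is an involution and the
    characteristic is 2. *)
Lemma diffs_nuniq s x : ~~ uniq s -> diffs s x = 0.
Proof.
elim: s => //= i s IH; rewrite negb_and negbK => /orP[/diff_diffs->//|/IH->].
exact: diff0.
Qed.

Lemma diffs_shift s g x h :
  diffs s (fun k => x (g^-1 * k)%g) h = diffs s x (g^-1 * h)%g.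
Proof. by elim: s h => //= i s IH h; rewrite /diff !IH mulgA. Qed.

(** For [j] other than [i], right multiplication by [u j] preserves the [i]-th coordinate, so
    [diff j] never mixes the two halves of [G] that this coordinate separates. *)
Lemma diffs_support s i x : i \notin s ->
  (forall g, c g i -> x g = 0) -> forall g, c g i -> diffs s x g = 0.
Proof.
move=> + x0; elim: s => [|j s IH]; first by move=> _; exact: x0.
rewrite in_cons negb_or eq_sym /= => /andP[/negPf ji /IH{}IH] g cg.
by rewrite /diff !IH ?addr0 // c_u ji addbF.
Qed.

(** By induction: [diff i] adds the value at [u i], whose [i]-th coordinate is set, whereas
    differences along other indices keep the support of [delta] where that coordinate vanishes. *)
Lemma diffs_delta s : uniq s -> diffs s delta 1%g = 1.
Proof.
elim: s => [|i s IH] /=; first by rewrite /delta eqxx.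
move=> /andP[si /IH]; rewrite /diff => ->.
rewrite (@diffs_support s i) ?addr0 //; last by rewrite c_u c_1 eqxx.
by move=> g cg; rewrite /delta; case: eqP cg => // ->; rewrite c_1.
Qed.

Lemma diffs_finite s x :
  finite_set [set g | x g != 0] -> finite_set [set g | diffs s x g != 0].
Proof.
move=> fx; elim: s => //= i s fs; set S := [set g | diffs s x g != 0] in fs.
have : finite_set (S `|` (fun g => g * u i)%g @` S).
  by rewrite finite_setU; split=> //; exact: finite_image.
apply: sub_finite_set => g /=; rewrite /diff.
have [->|] := eqVneq (diffs s x g) 0; last by left.
rewrite add0r; right; exists (g * u i)%g => //.
by rewrite -mulgA u_invol mulg1.
Qed.

Lemma diffs_near s (x : config G 'F_2) g :
  \forall z \near x, diffs s z g = diffs s x g.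
Proof.
elim: s g => [|i s IH] g; first exact: config_near.
by apply: filterS2 (IH g) (IH (g * u i)%g) => z /= + +; rewrite /diff => -> ->.
Qed.

(** These list the indices of [b_0, ..., b_(n-1)]; [evens n] does the same for the [a_k], and
    [tests n] adds [a_n] and [b_n] to [odds n]. *)
Definition odds n : seq nat := [seq k.*2.+1 | k <- iota 0 n].
Definition evens n : seq nat := [seq k.*2 | k <- iota 0 n].
Definition tests n : seq nat := [:: n.*2, n.*2.+1 & odds n].

Definition diff_set : set (config G 'F_2) :=
  [set x | forall n, diffs (tests n) x = 0].

Fact diff_closed : closed diff_set.
Proof.
move=> x clx n; apply/funext => g.
have [z [Xz <-]] := clx _ (diffs_near (tests n) x g).
by rewrite Xz.
Qed.

Fact diff_shift g x : diff_set x -> diff_set (shift g x).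
Proof.
by move=> Xx n; apply/funext => h; rewrite [LHS]diffs_shift Xx.
Qed.

Definition diff_subshift : subshift G 'F_2 := Subshift diff_closed diff_shift.

Fact diff_submod : GRing.submod_closed (cellwise_points diff_subshift).
Proof.
split=> [|a x y /set_mem Xx /set_mem Xy]; apply/mem_set => n.
  exact: diffs0.
by rewrite diffs_linear Xx Xy scaler0 addr0.
Qed.

Definition diff_vector_shift := cellwise_vector_shift diff_submod.

Lemma diffs_odds n x : diff_set x ->
  (forall g, c g n.*2 -> x g = 0) -> (forall g, c g n.*2.+1 -> x g = 0) ->
  diffs (odds n) x = 0.
Proof.
move=> Xx x0 x1; apply/funext => g.
have odd_n k : k \in odds n -> odd k /\ (k < n.*2.+1)%N.
  case/mapP=> m; rewrite mem_iota => /= mn ->.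
  by rewrite /= odd_double ltnS ltn_double.
have w0 h : c h n.*2 -> diffs (odds n) x h = 0.
  apply: diffs_support x0 h; apply/negP => /odd_n[].
  by rewrite odd_double.
have w1 h : c h n.*2.+1 -> diffs (odds n) x h = 0.
  by apply: diffs_support x1 h; apply/negP => /odd_n[]; rewrite ltnn.
have [/w0//|c0] := boolP (c g n.*2); have [/w1//|c1] := boolP (c g n.*2.+1).
(* The test at [g] has four terms, at [g], [g b_n], [g a_n] and [g a_n b_n]. In the last three,
   coordinate [2n] or [2n+1] is set, so only the term at [g] survives. *)
have := congr1 (@^~ g) (Xx n); rewrite /= /diff.
rewrite [diffs _ _ (g * u n.*2.+1)%g]w1; last by rewrite c_u eqxx (negPf c1).
rewrite [diffs _ _ (g * u n.*2)%g]w0; last by rewrite c_u eqxx (negPf c0).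
rewrite [diffs _ _ (_ * u n.*2.+1)%g]w0 ?addr0 // !c_u eqxx (negPf c0).
by rewrite gtn_eqF.
Qed.

(** The indicator function of [<a_0, ..., a_(n-1), b_n>]. *)
Definition witness n : V := diffs (n.*2.+1 :: evens n) delta.

Lemma witness_diff_set n : diff_set (witness n).
Proof.
move=> k; rewrite -diffs_cat; apply: diffs_nuniq.
apply/negP; rewrite cat_uniq => /and3P[_ + _]; apply/negP.
rewrite negbK; apply/hasP.
(* Each test repeats an index of the witness: [b_n] if [n <= k], and [a_k] if [k < n]. *)
have [nk|kn] := leqP n k.
  exists n.*2.+1; rewrite ?mem_head // !in_cons eqSS.
  move: nk; rewrite leq_eqVlt => /predU1P[->|nk]; first by rewrite eqxx orbT.
  by rewrite map_f ?orbT // mem_iota.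
exists k.*2; last exact: mem_head.
by rewrite in_cons map_f ?orbT // mem_iota.
Qed.

(** All indices involved are distinct, so [diffs_delta] applies; hence [witness n] violates the
    conclusion of [diffs_odds]. *)
Lemma witness_odds n : diffs (odds n) (witness n) 1%g = 1.
Proof.
rewrite -diffs_cat; apply: diffs_delta.
have odd_odds k : k \in odds n -> odd k && (k < n.*2)%N.
  case/mapP=> m; rewrite mem_iota => /= mn ->.
  by rewrite /= odd_double ltn_Sdouble.
have odd_evens k : k \in evens n -> ~~ odd k.
  by case/mapP=> m _ ->; rewrite odd_double.
have odds_uniq : uniq (odds n).
  by rewrite map_inj_uniq ?iota_uniq // => i j [] /double_inj.
have evens_uniq : uniq (evens n).
  by rewrite map_inj_uniq ?iota_uniq //; exact: double_inj.
rewrite cat_uniq odds_uniq /= evens_uniq negb_or -andbA; apply/and3P; split.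
- by apply/negP => /odd_odds; rewrite ltnNge leqnSn andbF.
- by apply/hasPn => k /odd_evens; apply: contra => /odd_odds /andP[].
- by rewrite andbT; apply/negP => /odd_evens; rewrite /= odd_double.
Qed.

(** The coordinate of [act g x] at [h] is [x (g^-1 * h)]. Taking [h = 1] gives the forward
    direction; conversely, finite support makes every coordinate vanish for all but finitely many
    [g]. *)
Lemma homoclinicP (x : diff_subshift) :
  homoclinic (X := diff_vector_shift) x <-> finite_set [set g | val x g != 0].
Proof.
split=> [hx|fx].
  have := hx _ (coord_near (0 : vs_space diff_vector_shift) 1%g).
  rewrite /fmap /cofinite_filter /= => fx.
  have := finite_image (fun g => g^-1)%g fx; apply: sub_finite_set => g /= xg.
  exists g^-1%g; last exact: invgK.
  by rewrite /= /shift invgK mulg1; exact/eqP.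
apply: subshift_cvg => h.
have := finite_image (fun g => h * g^-1)%g fx.
rewrite /cofinite_filter; apply: sub_finite_set => g /= xg.
exists (g^-1 * h)%g; last by rewrite invgM invgK mulgA mulgV mul1g.
by apply/eqP => x0; apply: xg; rewrite /= /shift.
Qed.

Lemma ex_not_finitely_orbit_generated :
  exists (A : finType) (X : vector_shift 'F_2 G A), ~ finitely_orbit_generated X.
Proof.
exists _, diff_vector_shift; case=> Y Yfin hY.
have orbitY : orbits Y `<=` homoclinic (X := diff_vector_shift).
  by rewrite hY; exact: sub_gen_smallest.
have act1 (y : diff_subshift) : act 1%g y = y.
  by apply/val_inj/funext => g; rewrite /= /shift invg1 mul1g.
pose F := \bigcup_(y in Y) [set g | val (y : diff_subshift) g != 0].
have [N c_N] := choice c_fin.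
have /finite_seqP[s sF] : finite_set F.
  apply: bigcup_finite => // y Yy; apply/homoclinicP/orbitY.
  by exists 1%g => //; exists y.
(* From index [n] on, every coordinate vanishes on [F], the union of the supports of the
   generators. *)
pose n := (\max_(g <- s) N g)%N.
have Y0 (y : diff_subshift) i g : Y y -> (n <= i)%N -> c g i -> val y g = 0.
  move=> Yy ni cgi; apply/eqP; apply: contraTT cgi => yg; apply/negbT/c_N.
  apply: leq_trans ni; apply: leq_bigmax_seq => //.
  by have : F g by [exists y]; rewrite sF.
(* A subgroup that contains the orbits of [Y], hence every homoclinic point, but not [witness n]. *)
pose Z := [set x : vs_space diff_vector_shift | diffs (odds n) (val x) = 0].
have /(_ Z)Zgen : forall H : set (vs_space diff_vector_shift),
    GRing.zmod_closed [in H] -> orbits Y `<=` H ->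
    homoclinic (X := diff_vector_shift) `<=` H.
  by move=> H Hz YH; rewrite hY; exact: smallest_sub.
have n2 : (n <= n.*2)%N by rewrite -addnn leq_addr.
have : Z (exist _ (witness n) (mem_set (witness_diff_set n))).
  apply: Zgen; last 1 first.
  - apply/homoclinicP; apply: diffs_finite.
    apply: sub_finite_set (finite_set1 1%g) => g /=.
    by have [//|g1] := eqVneq g 1%g; rewrite /delta (negPf g1) eqxx.
  - split=> [|x y /set_mem Zx /set_mem Zy]; apply/mem_set; first exact: diffs0.
    have := diffs_linear (odds n) (-1) (val y) (val x).
    rewrite Zx Zy scaler0 addr0 => e; apply: etrans e.
    by rewrite scaleN1r addrC.
  - move=> _ [g _ [y Yy <-]]; apply/funext => h.
    rewrite [LHS]diffs_shift diffs_odds //; first exact/set_mem/valP.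
    + by move=> k; exact: Y0.
    + by move=> k; apply: Y0 => //; exact: leqW.
by move=> /(congr1 (@^~ 1%g)); rewrite [LHS]witness_odds.
Qed.
End Differences.

(** * Independent involutions in the direct sum and in the lamplighter group *)

Section Z2.
Local Open Scope group_scope.
Variable I : choiceType.
Implicit Types (f : dsum I 'Z_2) (i j : I).

(** The group unit of ['Z_2] is the residue 0, so [1%R] is the nontrivial element. *)
Definition single i : dsum I 'Z_2 := [fsfun [fsfun] with i |-> 1%R].

Lemma singleE i j : single i j = if j == i then 1%R : 'Z_2 else 1 : 'Z_2.
Proof. by rewrite fsfun_withE fsfunE. Qed.

Lemma dsum_mul1E f g i : (f * g) i = f i * g i.
Proof. exact: dsum_mulE. Qed.

Lemma dsum_involutive f : f * f = 1.
Proof.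
apply/fsfunP => i; rewrite dsum_mul1E [RHS]dsum_oneE.
exact: addFF.
Qed.

Lemma dsum_commute f g : f * g = g * f.
Proof.
by apply/fsfunP => i; rewrite !dsum_mul1E; exact: addrC.
Qed.

Lemma dsum_mul_single f i j :
  ((f * single i) j != 1) = (f j != 1) (+) (i == j).
Proof.
rewrite dsum_mul1E singleE [j == i]eq_sym; have [ij|ij] := eqVneq i j.
  by case: (f j) => [[|[|]]].
by rewrite mulg1 addbF.
Qed.

Lemma dsum_finite (h : nat -> I) f : injective h ->
  exists N, forall k : nat, (N <= k)%N -> (f (h k) != 1) = false.
Proof.
move=> h_inj.
have : finite_set (h @^-1` [set` finsupp f])%classic.
  by apply: finite_preimage => // k l _ _; exact: h_inj.
move=> /finite_seqP[s sE].
exists (\max_(k <- s) k.+1)%N => k sk; apply/negP => fk.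
have : (h @^-1` [set` finsupp f])%classic k.
  by rewrite /= mem_finsupp; exact/negP.
rewrite sE /= => /(@leq_bigmax_seq _ _ xpredT succn) /(_ isT).
by rewrite ltnNge sk.
Qed.

End Z2.

Lemma dsum_not_generated :
  exists (A : finType) (X : vector_shift 'F_2 (dsum nat 'Z_2) A),
    ~ finitely_orbit_generated X.
Proof.
apply: (@ex_not_finitely_orbit_generated _ (@single nat) (fun f i => f i != 1%g)).
- by move=> i; exact: dsum_involutive.
- by move=> i j; exact: dsum_commute.
- exact: dsum_mul_single.
- by move=> i; rewrite dsum_oneE eqxx.
- by move=> f; exact: (@dsum_finite _ id).
Qed.

Lemma lamplighter_not_generated :
  exists (A : finType) (X : vector_shift 'F_2 lamplighter A),
    ~ finitely_orbit_generated X.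
Proof.
pose Q := Algebra.to_multiplicative int.
pose pos (i : nat) : Q := Posz i.
have pos_inj : injective pos by move=> i j [].
pose u i : lamplighter := (single (pos i), 1%g).
have uM i j : (u i * u j = (single (pos i) * single (pos j), 1) :> lamplighter)%g.
  by congr pair; rewrite /= ?translate1 ?mulg1.
(* Right multiplication of [(f, q)] by [u i] toggles the lamp at [q * pos i], so the [i]-th
   coordinate reads the lamp there, relative to the position [q]. *)
apply: (@ex_not_finitely_orbit_generated _ u
          (fun w i => w.1 (w.2 * pos i)%g != 1%g)).
- by move=> i; rewrite uM dsum_involutive.
- by move=> i j; rewrite !uM dsum_commute.
- move=> [f q] i j /=; rewrite mulg1 dsum_mul1E translateE mulgA mulVg mul1g.
  have := dsum_mul_single (translate q^-1%g f) (pos i) (pos j).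
  by rewrite dsum_mul1E translateE invgK (inj_eq pos_inj).
- by move=> i; rewrite dsum_oneE eqxx.
- move=> [f q]; apply: dsum_finite => i j /= e; apply: pos_inj.
  by rewrite -[pos i](mulKg q) e mulKg.
Qed.

Theorem proposition18 :
  (exists (A : finType) (X : vector_shift 'F_2 (dsum nat 'Z_2) A),
     ~ finitely_orbit_generated X) /\
  (exists (A : finType) (X : vector_shift 'F_2 lamplighter A),
     ~ finitely_orbit_generated X).
Proof.
split; [exact: dsum_not_generated | exact: lamplighter_not_generated].
Qed.
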